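(* Let $n\ge 2$, let players $1,\dots,n$ have values $v_1\ge\cdots\ge v_n>0$, and let $(r,m_1,\dots,m_r)$ be any tournament format. Then $$P(R_{1,s})\ge P(R_{2,s})\ge\cdots\ge P(R_{n,s}),\qquad s=1,\dots,r+1.$$
   Context: Random knockout tournament: there are $n\ge 2$ players $1,\dots,n$ with positive values $v_1,\dots,v_n$. A format is a tuple $(r,m_1,\dots,m_r)$ of positive integers with $\sum_{s=1}^r m_s = n-1$ and $2m_s \le r_s$ for each $s$, where $r_s = n-\sum_{j=1}^{s-1} m_j$ is the number of players still alive (not eliminated) at the start of round $s$. In round $s$, independently of the past given the set of alive players, $2m_s$ of the $r_s$ alive players are chosen uniformly at random and are uniformly randomly arranged into $m_s$ match pairs. A match between $i$ and $j$ is won by $i$ with probability $v_i/(v_i+v_j)$, independently of everything else. Losers are eliminated; the winners and the alive players not chosen to play advance to the next round. After round $r$ exactly one player remains, the winner of the tournament. For $s=1,\dots,r$, $R_{i,s}$ is the event that player $i$ reaches round $s$ (is still alive at the start of round $s$), and $R_{i,r+1}$ is the event that $i$ wins the tournament. *)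

(* Defs.v *)
From mathcomp Require Import all_boot all_order all_algebra.

Set Implicit Arguments.
Unset Strict Implicit.
Unset Printing Implicit Defensive.

Import Order.TTheory GRing.Theory Num.Theory.

Local Open Scope ring_scope.

(** The tournament lives on a finite probability space of full histories.
    Players are the elements of ['I_n] (player [i] here is player [i + 1] in
    1-based numbering).  For [t : 'I_r], [m t] is the number of matches of
    round [t.+1]: rounds are numbered [1 .. r], as on paper. *)

(** In the last clause, the right-hand side is the number of players alive at
    the start of round [s.+1]; the subtraction is never truncated because of
    the third clause. *)
Definition is_format (n r : nat) (m : 'I_r -> nat) : Prop :=
  [/\ (0 < r)%N,
      forall s : 'I_r, (0 < m s)%N,
      (\sum_(s < r) m s)%N = (n - 1)%N
    & forall s : 'I_r, (2 * m s <= n - \sum_(j < r | (j < s)%N) m j)%N].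

Definition uniform (R : realFieldType) (T : finType) (D : {set T}) (x : T) : R :=
  (x \in D)%:R / #|D|%:R.

(** What happens in one round: the set of players who play, the set of
    matches (each match being the set of its two players), and the set of
    players who win their match. *)
Definition round (n : nat) : finType :=
  ({set 'I_n} * {set {set 'I_n}} * {set 'I_n})%type.

Definition drawn (n : nat) (x : round n) : {set 'I_n} := x.1.1.
Definition matches (n : nat) (x : round n) : {set {set 'I_n}} := x.1.2.
Definition winners (n : nat) (x : round n) : {set 'I_n} := x.2.
Definition losers (n : nat) (x : round n) : {set 'I_n} := drawn x :\: winners x.

Definition draws (n : nat) (A : {set 'I_n}) (k : nat) : {set {set 'I_n}} :=
  [set S : {set 'I_n} | (S \subset A) && (#|S| == 2 * k)%N].

Definition pairings (n : nat) (S : {set 'I_n}) : {set {set {set 'I_n}}} :=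
  [set M : {set {set 'I_n}} | partition M S && [forall e in M, #|e| == 2]].

(** Probability that the winners of the matches [M] between the players of
    [S] are exactly [W].  [W] must contain exactly one player of each match;
    then, for a match [e], [e :&: W] and [e :\: W] are the singletons of its
    winner and of its loser, and the matches are decided independently. *)
Definition result_prob (R : realFieldType) (n : nat) (v : 'I_n -> R)
    (S : {set 'I_n}) (M : {set {set 'I_n}}) (W : {set 'I_n}) : R :=
  (is_transversal W M S)%:R *
  \prod_(e in M) \prod_(i in e :&: W) \prod_(j in e :\: W) (v i / (v i + v j)).

(** Conditional law of a round with [k] matches, given that [A] is the set of
    players alive at its start. *)
Definition round_prob (R : realFieldType) (n : nat) (v : 'I_n -> R)
    (k : nat) (A : {set 'I_n}) (x : round n) : R :=
  uniform R (draws A k) (drawn x) *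
  uniform R (pairings (drawn x)) (matches x) *
  result_prob v (drawn x) (matches x) (winners x).

Definition history (n r : nat) : finType := {ffun 'I_r -> round n}.

(** Players alive at the start of round [s], for [1 <= s <= r.+1]; for
    [s = r.+1] these are the players left after the last round. *)
Definition alive (n r : nat) (w : history n r) (s : nat) : {set 'I_n} :=
  ~: \bigcup_(t < r | (t.+1 < s)%N) losers (w t).

Definition history_prob (R : realFieldType) (n r : nat) (v : 'I_n -> R)
    (m : 'I_r -> nat) (w : history n r) : R :=
  \prod_(t < r) round_prob v (m t) (alive w t.+1) (w t).

Definition Pr (R : realFieldType) (n r : nat) (v : 'I_n -> R)
    (m : 'I_r -> nat) (E : {set history n r}) : R :=
  \sum_(w in E) history_prob v m w.

(** The event that player [i] reaches round [s]; for [s = r.+1], that [i]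
    wins the tournament, being the player left after round [r]. *)
Definition reaches (n r : nat) (i : 'I_n) (s : nat) : {set history n r} :=
  [set w : history n r | i \in alive w s].

(* Main.v *)
Require Import Defs.
From mathcomp Require Import all_boot all_order all_fingroup all_algebra.

(** Fix players [a] and [b] with [v b <= v a] and let [sigma] be the
    transposition exchanging them.  Exchanging the roles of [a] and [b] in a
    whole history does not compare the two players: as long as both are alive,
    exchanging them may raise or lower the probability of the history.  The
    exchange is only favourable from the round in which [b] is out of the
    tournament, so the proof goes backwards, one round at a time.

    Write [expect v k h A] for the mean of [h] over the set of survivors of a
    round with [k] matches started from [A].  A pair of functions [h1], [h2] of
    the set of alive players (think of the chances that [a], resp. [b], reaches
    the round of interest) is in domination when [h1] is nonnegative, [h2]
    vanishes once [b] is out, [h1] is at least [h2] on every set containing both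
    players, and [h1] at a set with [a] and without [b] is at least [h2] at the
    same set with [b] in place of [a].

    [dominates_expect] says that [expect] preserves domination.  Outcomes in
    which both players survive are compared as they stand.  An outcome in which
    [a] survives and [b] does not is matched with its image under [sigma], which
    is no more likely: match by match, the winner of the image is at most as
    strong as the original winner and the loser at least as strong as the
    original loser ([le_round_prob]).  The outcomes not covered in this way
    contribute nothing to [b].

    Starting from the indicators that [a] and [b] are alive, this gives the
    comparison at the end of a tournament ([le_reaches_last]).  For an earlier
    round [s], the rounds played after [s] have to be summed out; as every round
    has total mass [1] or [0], according to whether enough players are alive,
    and the number of survivors is determined, averaging a function of the
    number of alive players gives such a function again ([expect_card]).
    Carrying an arbitrary nonnegative function of that number along the
    induction ([le_reaches]) reduces the general case to the previous one. *)

Set Implicit Arguments.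
Unset Strict Implicit.
Unset Printing Implicit Defensive.

Import Order.TTheory GRing.Theory Num.Theory.

Local Open Scope ring_scope.

(** * Relabelling the players of a round *)

Section Equivariance.

Context {R : realFieldType} {n : nat}.
Implicit Types (v : 'I_n -> R) (A D W : {set 'I_n}) (M : {set {set 'I_n}}).
Implicit Types (x : round n) (s : {perm 'I_n}).

Definition relabel s x : round n :=
  (s @: drawn x, [set s @: e | e : {set 'I_n} in matches x], s @: winners x).

Lemma relabel_inj s : injective (relabel s).
Proof.
have injs := imset_inj (@perm_inj _ s).
move=> [[D M] W] [[D' M'] W'] [eD eM eW].
congr (_, _, _); [exact: injs eD | exact: imset_inj injs _ _ eM | exact: injs eW].
Qed.

Lemma imsetD_inj (T T' : finType) (f : T -> T') (A B : {set T}) :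
  injective f -> f @: (A :\: B) = f @: A :\: f @: B.
Proof.
move=> injf; apply/setP => y; rewrite inE.
apply/imsetP/andP => [[x /setDP[Ax Bx] ->]|[By /imsetP[x Ax yE]]].
  by rewrite !mem_imset.
by exists x; rewrite // inE Ax andbT -(mem_imset _ x injf) -yE.
Qed.

Lemma imset_subset_inj (T T' : finType) (f : T -> T') (A B : {set T}) :
  injective f -> (f @: A \subset f @: B) = (A \subset B).
Proof.
move=> injf; apply/idP/idP => [/subsetP sAB|]; last exact: imsetS.
by apply/subsetP => x Ax; rewrite -(mem_imset _ _ injf) sAB ?imset_f.
Qed.

Lemma losers_relabel s x : losers (relabel s x) = s @: losers x.
Proof. by rewrite [RHS]imsetD_inj //; apply: perm_inj. Qed.

Lemma uniform_preim (T : finType) (g : T -> T) (D D' : {set T}) (x : T) :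
  injective g -> (forall y, (g y \in D') = (y \in D)) ->
  uniform R D' (g x) = uniform R D x.
Proof.
move=> injg gD; rewrite /uniform gD; congr (_ / _%:R).
rewrite -(card_imset D injg); apply: eq_card => y.
have [h _ hK] := injF_bij injg.
by rewrite -(hK y) gD mem_imset.
Qed.

Lemma draws_relabel s A k D : (s @: D \in draws (s @: A) k) = (D \in draws A k).
Proof.
rewrite !inE card_imset; last exact: perm_inj.
by rewrite imset_subset_inj //; apply: perm_inj.
Qed.

Lemma pairings_relabel s D M :
  ([set s @: e | e : {set 'I_n} in M] \in pairings (s @: D)) = (M \in pairings D).
Proof.
rewrite !inE imset_partition; last exact: perm_inj.
congr (_ && _); apply/forall_inP/forall_inP => cM e Me.
  by rewrite -(card_imset _ (@perm_inj _ s)) cM // imset_f.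
by case/imsetP: Me => e' Me' ->; rewrite card_imset ?cM //; apply: perm_inj.
Qed.

Lemma transversal_relabel s W M D :
  is_transversal (s @: W) [set s @: e | e : {set 'I_n} in M] (s @: D) =
  is_transversal W M D.
Proof.
have injs := @perm_inj _ s.
rewrite /is_transversal imset_partition // imset_subset_inj //; congr [&& _, _ & _].
apply/forall_inP/forall_inP => cM e Me.
  rewrite -(card_imset _ injs) imsetI; last exact: in2W.
  by rewrite cM // imset_f.
case/imsetP: Me => e' Me' ->.
by rewrite -imsetI; [rewrite card_imset ?cM | exact: in2W].
Qed.

Lemma result_prob_relabel v s D M W :
  result_prob v (s @: D) [set s @: e | e : {set 'I_n} in M] (s @: W) =
  result_prob (v \o s) D M W.
Proof.
have injs := @perm_inj _ s.
rewrite /result_prob transversal_relabel; congr (_ * _).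
rewrite big_imset /=; last by apply: in2W; apply: imset_inj.
apply: eq_bigr => e _; rewrite -imsetI; last exact: in2W.
rewrite big_imset /=; last exact: in2W.
apply: eq_bigr => i _; rewrite -imsetD_inj //.
by rewrite big_imset //=; exact: in2W.
Qed.

(** The draw and the pairing are blind to the names of the players; only the
    values have to be transported. *)
Lemma round_prob_relabel v k s A x :
  round_prob v k (s @: A) (relabel s x) = round_prob (v \o s) k A x.
Proof.
have injs := imset_inj (@perm_inj _ s).
rewrite /round_prob result_prob_relabel; congr (_ * _ * _).
  apply: (uniform_preim (g := fun D => s @: D)) => // D.
  by rewrite draws_relabel.
apply: (uniform_preim (g := fun M => [set s @: e | e : {set 'I_n} in M])).
  exact: imset_inj.
by move=> M; rewrite pairings_relabel.
Qed.

End Equivariance.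

(** * A round in which the stronger player survives and the weaker does not *)

Section Comparison.

Context {R : realFieldType} {n : nat}.
Implicit Types (v : 'I_n -> R) (A D W : {set 'I_n}) (M : {set {set 'I_n}}).
Implicit Types (x : round n).

Lemma uniform_ge0 (T : finType) (D : {set T}) (x : T) : 0 <= uniform R D x.
Proof. by rewrite divr_ge0 ?ler0n. Qed.

Lemma result_prob_ge0 v D M W :
  (forall i, 0 < v i) -> 0 <= result_prob v D M W.
Proof.
move=> v0; rewrite mulr_ge0 ?ler0n //.
do 3!apply: prodr_ge0 => ? _.
by rewrite divr_ge0 ?addr_ge0 // ltW.
Qed.

Lemma round_prob_ge0 v k A x :
  (forall i, 0 < v i) -> 0 <= round_prob v k A x.
Proof.
move=> v0; apply: mulr_ge0; last exact: result_prob_ge0.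
by apply: mulr_ge0; apply: uniform_ge0.
Qed.

(** The factor [v i / (v i + v j)] of a match won by [i] over [j] increases with
    the value of the winner and decreases with that of the loser. *)
Lemma le_result_prob v v' D M W :
  (forall i, 0 < v i) -> (forall i, 0 < v' i) ->
  {in W, forall i, v i <= v' i} ->
  {in D :\: W, forall j, v' j <= v j} ->
  result_prob v D M W <= result_prob v' D M W.
Proof.
move=> v0 v'0 leW leL; rewrite /result_prob.
case: (boolP (is_transversal W M D)) => [/and3P[pM _ _]|_]; last by rewrite !mul0r.
rewrite !mul1r.
have ge0 (u : 'I_n -> R) i j : (forall i, 0 < u i) -> 0 <= u i / (u i + u j).
  by move=> u0; rewrite divr_ge0 ?addr_ge0 // ltW.
apply: ler_prod => e Me; apply/andP; split.
  by apply: prodr_ge0 => i _; apply: prodr_ge0 => j _; apply: ge0.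
apply: ler_prod => i /setIP[_ Wi]; apply/andP; split.
  by apply: prodr_ge0 => j _; apply: ge0.
apply: ler_prod => j /setDP[ej W'j]; rewrite ge0 //=.
have lei := leW _ Wi.
have lej : v' j <= v j.
  by apply: leL; rewrite inE W'j (subsetP (partitionS pM Me)).
rewrite ler_pdivrMr ?addr_gt0 // mulrAC ler_pdivlMr ?addr_gt0 //.
rewrite !mulrDr [v' i * v i]mulrC lerD2l.
by rewrite ler_pM // ltW.
Qed.

(** If [a] survives, he wins or does not play, and if [b] does not survive, he
    loses or does not play.  So giving [a] the value of [b] and conversely can
    only lower the values of winners and raise those of losers. *)
Lemma le_round_prob v k A x (a b : 'I_n) :
  (forall i, 0 < v i) -> v b <= v a ->
  a \in A :\: losers x -> b \notin A :\: losers x ->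
  round_prob v k (tperm a b @: A) (relabel (tperm a b) x) <= round_prob v k A x.
Proof.
move=> v0 leba; rewrite round_prob_relabel /round_prob !inE.
have [xD|/negbTE xD] := boolP (drawn x \in draws A k); last first.
  by rewrite /uniform xD !mul0r.
have /subsetP DA : drawn x \subset A by move: xD; rewrite inE => /andP[].
have [tr|/negbTE tr] :=
    boolP (is_transversal (winners x) (matches x) (drawn x)); last first.
  by rewrite /result_prob tr !mul0r !mulr0.
have WD := subsetP (transversal_sub tr).
move=> /andP[aL aA] bL.
have bW : b \notin winners x.
  by apply: contra bL => Wb; rewrite Wb DA ?WD.
apply: ler_wpM2l; first by apply: mulr_ge0; apply: uniform_ge0.
apply: le_result_prob => // i /=; first exact: v0.
  by case: tpermP => // -> //; rewrite (negbTE bW).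
case/setDP=> Di /negbTE iW; case: tpermP => // ia; last by rewrite ia.
by rewrite -ia iW Di in aL.
Qed.

End Comparison.

(** * Total mass of the results of the matches *)

Section RoundMass.

Context {R : realFieldType} {n : nat}.
Implicit Types (v : 'I_n -> R) (A D W : {set 'I_n}) (M : {set {set 'I_n}}).
Implicit Types (x : round n).

(** Needed because a uniform law on the empty set has mass [0]. *)
Lemma pairings_neq0 k D : (#|D| = 2 * k)%N -> pairings D != set0.
Proof.
elim: k D => [|k IHk] D cD.
  have -> : D = set0 by apply: cards0_eq; rewrite cD.
  apply/set0Pn; exists set0; rewrite inE partition_set0 eqxx /=.
  by apply/forall_inP => e; rewrite inE.
have /card_gt0P[x Dx] : (0 < #|D|)%N by rewrite cD.
have cDx : (#|D :\ x| = (2 * k).+1)%N.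
  by move: (cardsD1 x D); rewrite Dx cD mulnS => -[].
have /card_gt0P[y] : (0 < #|D :\ x|)%N by rewrite cDx.
rewrite !inE => /andP[yx Dy].
have cDxy : (#|D :\ x :\ y| = 2 * k)%N.
  by move: (cardsD1 y (D :\ x)); rewrite !inE yx Dy cDx => -[].
have /set0Pn[M] := IHk _ cDxy; rewrite inE => /andP[pM /forall_inP cM].
have DE : D = [set x; y] :|: (D :\ x :\ y).
  by rewrite -setUA setD1K ?setD1K // !inE yx.
apply/set0Pn; exists ([set x; y] |: M); rewrite inE DE partitionU1 //=; last 2 first.
- by apply/set0Pn; exists x; rewrite !inE eqxx.
- rewrite disjoint_sym -setI_eq0; apply/eqP/setP=> z; rewrite !inE.
  by case: (z == x); case: (z == y); rewrite ?andbF.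
apply/forall_inP => e; rewrite !inE => /predU1P[->|/cM //].
by rewrite cards2 [x == y]eq_sym yx.
Qed.

(** Choosing one element in each block of a trivial-intersection family gives a
    set that meets each block in the chosen element only; this is how
    transversals correspond to choice functions. *)
Lemma imset_section M (f : {set 'I_n} -> 'I_n) e :
  trivIset M -> {in M, forall e, f e \in e} -> e \in M ->
  [set f e | e in M] :&: e = [set f e].
Proof.
move=> tM fM Me; apply/setP => i; rewrite !inE.
apply/andP/eqP => [[/imsetP[e' Me' ->] e'e]|->]; last by rewrite fM ?imset_f.
congr (f _); apply/eqP; apply: contraTT e'e => ne.
have /trivIsetP/(_ _ _ Me' Me ne)/disjointFr -> // := tM; exact: fM.
Qed.

(** Distributing [\prod_(e in M) \sum_(i in e) F e i], a product of factors [1],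
    gives a sum over the functions choosing a winner in each match, and these
    functions are in bijection with the transversals of [M].  The player [a] only
    serves as the value of the choice functions outside [M]. *)
Lemma sum_result_prob (a : 'I_n) v D M :
  (forall i, 0 < v i) -> M \in pairings D ->
  \sum_W result_prob v D M W = 1.
Proof.
move=> v0; rewrite inE => /andP[pM /forall_inP cM].
have tM := partition_trivIset pM.
(* [e :\ i] is the opponent of [i], as matches have two players. *)
pose F (e : {set 'I_n}) i := \prod_(j in e :\ i) (v i / (v i + v j)).
have F1 e : e \in M -> \sum_(i in e) F e i = 1.
  move=> /cM /cards2P [x [y [xy ->]]].
  rewrite big_setU1 ?inE //= big_set1 /F.
  have -> : [set x; y] :\ x = [set y] by rewrite setU1K ?inE.
  have -> : [set x; y] :\ y = [set x] by rewrite setUC setU1K ?inE // eq_sym.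
  by rewrite !big_set1 [v y + _]addrC -mulrDl divff // gt_eqF ?addr_gt0.
transitivity (\prod_(e in M) \sum_(i in e) F e i); last first.
  by rewrite big1.
rewrite (big_distr_big_dep a) /= /result_prob.
rewrite (bigID (fun W => is_transversal W M D)) /=.
rewrite [X in _ + X]big1 ?addr0; last first.
  by move=> W /negbTE ->; rewrite mul0r.
pose h (f : {ffun {set 'I_n} -> 'I_n}) := [set f e | e in M].
pose h' W := [ffun e => if e \in M then transversal_repr a W e else a].
rewrite (reindex_onto h h') /=; last first.
  move=> W tr; rewrite -[RHS](im_transversal_repr tr a).
  by apply: eq_in_imset => e Me; rewrite ffunE Me.
have trf (f : {ffun {set 'I_n} -> 'I_n}) :
    {in M, forall e, f e \in e} -> is_transversal (h f) M D.
  move=> fM; apply/and3P; split=> //.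
    apply/subsetP => _ /imsetP[e Me ->].
    exact: (subsetP (partitionS pM Me)) (fM _ Me).
  by apply/forall_inP => e Me; rewrite /h imset_section // cards1.
apply: eq_big => [f|f].
  apply/andP/pfamilyP => [[tr /eqP hf]|[supp fM]].
    split=> [|e Me]; last by rewrite -hf ffunE Me (repr_mem_pblock tr).
    by apply/supportP => e /negbTE Me; rewrite -hf ffunE Me.
  have tr := trf _ fM; split => //; apply/eqP/ffunP => e; rewrite ffunE.
  case: ifPn => Me; last by rewrite (supportP supp).
  apply: set1_inj; rewrite -(setI_transversal_pblock tr a Me).
  exact: imset_section.
move=> /andP[tr /eqP hf]; rewrite tr mul1r; apply: eq_bigr => e Me.
have fM : {in M, forall e, f e \in e}.
  by move=> e' Me'; rewrite -hf ffunE Me' (repr_mem_pblock tr).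
have hfe : h f :&: e = [set f e] by apply: imset_section.
by rewrite -[e :\: h f]set0U -(setDv e) -setDIr setIC hfe big_set1.
Qed.

End RoundMass.

(** * Averaging over one round *)

Section Expect.

Context {R : realFieldType} {n : nat}.
Implicit Types (v : 'I_n -> R) (A D W : {set 'I_n}) (M : {set {set 'I_n}}).
Implicit Types (x : round n).

Lemma sum_uniform (T : finType) (D : {set T}) :
  \sum_x uniform R D x = (D != set0)%:R.
Proof.
rewrite -mulr_suml -natr_sum -cards_eq0.
have -> : (\sum_x (x \in D) = #|D|)%N by rewrite -sum1_card [RHS]big_mkcond.
by case: eqP => [->|/eqP cD]; rewrite ?mul0r // divff // pnatr_eq0.
Qed.

Lemma sum_round_prob (a : 'I_n) v k A :
  (forall i, 0 < v i) ->
  \sum_x round_prob v k A x = (2 * k <= #|A|)%N%:R.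
Proof.
move=> v0.
rewrite -(pair_bigA _ (fun DM W => round_prob v k A (DM, W))) /=.
transitivity (\sum_D \sum_M uniform R (draws A k) D * uniform R (pairings D) M).
  rewrite [RHS]pair_bigA /=; apply: eq_bigr => -[D M] _ /=.
  rewrite /round_prob /drawn /matches /winners /= -mulr_sumr.
  have [pM|/negbTE pM] := boolP (M \in pairings D).
    by rewrite sum_result_prob ?mulr1.
  by rewrite /uniform pM mul0r !mulr0 mul0r.
under eq_bigr do rewrite -mulr_sumr sum_uniform.
transitivity (\sum_D uniform R (draws A k) D).
  apply: eq_bigr => D _; have [|/negbTE DA] := boolP (D \in draws A k).
    by rewrite inE => /andP[_ /eqP/pairings_neq0->]; rewrite mulr1.
  by rewrite /uniform DA !mul0r.
by rewrite sum_uniform -card_gt0 cards_draws bin_gt0.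
Qed.

(** The winners form a transversal of the [k] matches, so [k] of the [2 * k]
    players drawn are eliminated. *)
Lemma card_survivors v k A x :
  round_prob v k A x != 0 -> #|A :\: losers x| = (#|A| - k)%N.
Proof.
rewrite /round_prob /uniform /result_prob.
have [|_] := boolP (drawn x \in _); last by rewrite !mul0r eqxx.
rewrite inE => /andP[DA /eqP cD].
have [|_] := boolP (matches x \in _); last by rewrite mul0r mulr0 mul0r eqxx.
rewrite inE => /andP[_ /forall_inP cM].
have [tr _|_] := boolP (is_transversal _ _ _); last by rewrite mul0r mulr0 eqxx.
have WD := transversal_sub tr.
have pM : partition (matches x) (drawn x) by case/and3P: tr.
have cW : #|winners x| = k.
  rewrite (card_transversal tr).
  have /card_uniform_partition := fun e He => eqP (cM e He).
  by move/(_ _ pM)/eqP; rewrite cD mulnC eqn_pmul2r // => /eqP ->.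
have LA : losers x \subset A := subset_trans (subsetDl _ _) DA.
rewrite cardsD (setIidPr LA) /losers cardsD (setIidPr WD) cW cD.
by rewrite mul2n -addnn addnK.
Qed.

Definition expect v k (h : {set 'I_n} -> R) A : R :=
  \sum_x round_prob v k A x * h (A :\: losers x).

Lemma expect_card (a : 'I_n) v k (g : nat -> R) A :
  (forall i, 0 < v i) ->
  expect v k (fun B => g #|B|) A = (2 * k <= #|A|)%N%:R * g (#|A| - k)%N.
Proof.
move=> v0; rewrite -(sum_round_prob a _ _ v0) mulr_suml; apply: eq_bigr => x _.
by have [->|/card_survivors->] := eqVneq (round_prob v k A x) 0; rewrite ?mul0r.
Qed.

(** [h1 A] and [h2 A] stand for the chances of [a] and of [b] from the set [A] of
    alive players; in the last clause [b] takes the place of [a] among the same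
    opponents, so that his chances are compared with those of [a] without any
    confrontation of the two. *)
Definition dominates (a b : 'I_n) (h1 h2 : {set 'I_n} -> R) : Prop :=
  [/\ forall A, 0 <= h1 A,
      forall A, b \notin A -> h2 A = 0,
      forall A, a \in A -> b \in A -> h2 A <= h1 A
    & forall A, a \in A -> b \notin A -> h2 (tperm a b @: A) <= h1 A].

Lemma tperm_imset_id (a b : 'I_n) A : a \in A -> b \in A -> tperm a b @: A = A.
Proof.
move=> Aa Ab; apply/setP => i.
rewrite -[i in LHS](tpermK a b) mem_imset; last exact: perm_inj.
by case: tpermP => [->|->|//]; rewrite ?Aa ?Ab.
Qed.

Lemma mem_tpermR (a b : 'I_n) A : (b \in tperm a b @: A) = (a \in A).
Proof. by rewrite -{1}(tpermL a b) mem_imset //; apply: perm_inj. Qed.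

Lemma mem_tpermL (a b : 'I_n) A : (a \in tperm a b @: A) = (b \in A).
Proof. by rewrite -{1}(tpermR a b) mem_imset //; apply: perm_inj. Qed.

(** When [a] does not survive, [b] does not survive in the relabelled outcome, so
    the left-hand side vanishes; otherwise both factors decrease. *)
Lemma le_round_term v k a b h1 h2 A x :
  (forall i, 0 < v i) -> v b <= v a -> dominates a b h1 h2 ->
  ~~ ((a \in A :\: losers x) && (b \in A :\: losers x)) ->
  round_prob v k (tperm a b @: A) (relabel (tperm a b) x) *
    h2 ((tperm a b @: A) :\: losers (relabel (tperm a b) x)) <=
  round_prob v k A x * h1 (A :\: losers x).
Proof.
move=> v0 vab [h1_ge0 h2b _ h21].
rewrite losers_relabel -imsetD_inj; last exact: perm_inj.
have [aS /= bS|aS _] := boolP (a \in _); last first.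
  by rewrite h2b ?mem_tpermR // mulr0 mulr_ge0 ?round_prob_ge0.
apply: le_trans (_ : _ * h1 (A :\: losers x) <= _).
  by apply: ler_wpM2l; [exact: round_prob_ge0 | exact: h21].
by apply: ler_wpM2r => //; apply: le_round_prob.
Qed.

(** When both players are alive, the outcomes that leave both alive are compared
    term by term; the set of the other outcomes is stable under the exchange of
    [a] and [b], so the sum for [b] can be reindexed by this exchange before
    [le_round_term] is applied. *)
Lemma dominates_expect v k a b h1 h2 :
  (forall i, 0 < v i) -> v b <= v a -> dominates a b h1 h2 ->
  dominates a b (expect v k h1) (expect v k h2).
Proof.
move=> v0 vab dom; have [h1_ge0 h2b h21 _] := dom; split.
- by move=> A; apply: sumr_ge0 => x _; rewrite mulr_ge0 ?round_prob_ge0.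
- move=> A bA; apply: big1 => x _.
  by rewrite h2b ?mulr0 // inE (negbTE bA) andbF.
- move=> A aA bA; pose both x := (a \in A :\: losers x) && (b \in A :\: losers x).
  rewrite /expect (bigID both) [X in _ <= X](bigID both) /=; apply: lerD.
    apply: ler_sum => x /andP[aS bS].
    by apply: ler_wpM2l; [exact: round_prob_ge0 | exact: h21].
  rewrite (reindex_inj (@relabel_inj _ (tperm a b))) /=.
  have tA := tperm_imset_id aA bA.
  have bothE x : both (relabel (tperm a b) x) = both x.
    rewrite /both losers_relabel -{1 2}tA -imsetD_inj; last exact: perm_inj.
    by rewrite mem_tpermL mem_tpermR andbC.
  under eq_bigl do rewrite bothE.
  by apply: ler_sum => x bx; have := le_round_term k v0 vab dom bx; rewrite tA.
- (* [b] is already out, so that every outcome falls under [le_round_term]. *)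
  move=> A aA bA; rewrite /expect (reindex_inj (@relabel_inj _ (tperm a b))) /=.
  apply: ler_sum => x _; apply: le_round_term => //.
  by rewrite !inE (negbTE bA) !andbF.
Qed.

End Expect.

(** * Appending a round to a history *)

Section Histories.

Context {n : nat}.

Definition extend r (w : history n r) (x : round n) : history n r.+1 :=
  [ffun t => if unlift ord_max t is Some t' then w t' else x].

Lemma extend_widen r (w : history n r) x t :
  extend w x (widen_ord (leqnSn r) t) = w t.
Proof.
rewrite ffunE; have -> : widen_ord (leqnSn r) t = lift ord_max t.
  by apply: val_inj; rewrite /= /bump leqNgt ltn_ord.
by rewrite liftK.
Qed.

Lemma extend_max r (w : history n r) x : extend w x ord_max = x.
Proof. by rewrite ffunE unlift_none. Qed.

Lemma sum_history (V : nmodType) r (F : history n r.+1 -> V) :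
  \sum_w F w = \sum_(w : history n r) \sum_x F (extend w x).
Proof.
rewrite pair_bigA /= (reindex (fun p : history n r * round n => extend p.1 p.2)) //.
exists (fun w : history n r.+1 =>
  ([ffun t => w (widen_ord (leqnSn r) t)], w ord_max)) => [[w x]|w] _ /=.
  congr (_, _); last exact: extend_max.
  by apply/ffunP => t; rewrite ffunE extend_widen.
apply/ffunP => t; rewrite ffunE; case: unliftP => [t'|] -> //.
by rewrite ffunE; congr (w _); apply: val_inj; rewrite /= /bump leqNgt ltn_ord.
Qed.

Lemma alive_extend r (w : history n r) x s :
  (s <= r.+1)%N -> alive (extend w x) s = alive w s.
Proof.
move=> sr; rewrite /alive big_mkcond big_ord_recr /= ltnNge sr /= setU0.
rewrite [in RHS]big_mkcond; congr (~: _).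
by apply: eq_bigr => t _; rewrite extend_widen.
Qed.

Lemma alive_extend_last r (w : history n r) x :
  alive (extend w x) r.+2 = alive w r.+1 :\: losers x.
Proof.
rewrite /alive big_mkcond big_ord_recr /= ltnSn extend_max setDE -setCU.
congr (~: (_ :|: _)); rewrite [in RHS]big_mkcond.
by apply: eq_bigr => t _; rewrite extend_widen !ltnS ltn_ord ltnW.
Qed.

Lemma mem_reaches r (w : history n r) i s :
  (w \in reaches r i s) = (i \in alive w s).
Proof. by rewrite inE. Qed.

Lemma history_prob_extend (R : realFieldType) (v : 'I_n -> R) r m
    (w : history n r) x :
  history_prob v m (extend w x) =
  history_prob v (fun t => m (widen_ord (leqnSn r) t)) w *
    round_prob v (m ord_max) (alive w r.+1) x.
Proof.
rewrite /history_prob big_ord_recr /= extend_max alive_extend //; congr (_ * _).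
by apply: eq_bigr => t _; rewrite extend_widen alive_extend // ltnS ltnW.
Qed.

End Histories.

(** * Comparison of the two players over all rounds *)

Section Main.

Context {R : realFieldType} {n : nat}.
Implicit Types (v : 'I_n -> R).

(** Summing out the last round turns [h1] and [h2] into their averages over it,
    which are still in domination; when no round is left, both players are alive
    and the third clause of domination concludes. *)
Lemma le_sum_history v a b r m (h1 h2 : {set 'I_n} -> R) :
  (forall i, 0 < v i) -> v b <= v a -> dominates a b h1 h2 ->
  \sum_(w : history n r) history_prob v m w * h2 (alive w r.+1) <=
  \sum_(w : history n r) history_prob v m w * h1 (alive w r.+1).
Proof.
move=> v0 vab; elim: r m h1 h2 => [|r IHr] m h1 h2 dom.
  apply: ler_sum => w _; rewrite /history_prob big_ord0 !mul1r.
  have -> : alive w 1 = setT by rewrite /alive big_pred0 ?setC0.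
  by case: dom => _ _ h21 _; apply: h21; rewrite inE.
have peel h : \sum_(w : history n r.+1) history_prob v m w * h (alive w r.+2) =
    \sum_(w : history n r) history_prob v (fun t => m (widen_ord (leqnSn r) t)) w *
      expect v (m ord_max) h (alive w r.+1).
  rewrite sum_history; apply: eq_bigr => w _; rewrite mulr_sumr.
  by apply: eq_bigr => x _; rewrite history_prob_extend alive_extend_last mulrA.
by rewrite !peel; apply: IHr; apply: dominates_expect.
Qed.

Lemma le_reaches_last v a b r m (g : nat -> R) :
  (forall i, 0 < v i) -> v b <= v a -> (forall c, 0 <= g c) ->
  \sum_(w in reaches r b r.+1) history_prob v m w * g #|alive w r.+1| <=
  \sum_(w in reaches r a r.+1) history_prob v m w * g #|alive w r.+1|.
Proof.
move=> v0 vab g0.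
pose h c (A : {set 'I_n}) := if c \in A then g #|A| else 0.
have hE c : \sum_(w in reaches r c r.+1) history_prob v m w * g #|alive w r.+1| =
    \sum_(w : history n r) history_prob v m w * h c (alive w r.+1).
  rewrite big_mkcond; apply: eq_bigr => w _; rewrite mem_reaches /h.
  by case: ifP => // _; rewrite mulr0.
rewrite !hE; apply: (le_sum_history (a := a) (b := b)) => //.
split=> A; rewrite /h.
- by case: ifP.
- by move=> bA; rewrite (negbTE bA).
- by move=> aA bA; rewrite aA bA.
by move=> aA _; rewrite mem_tpermR aA card_imset //; apply: perm_inj.
Qed.

(** The function [g] of the number of alive players is what keeps the induction
    going: removing a round played after [s] replaces it with another one.  When
    [s] is the final stage, the claim is [le_reaches_last]. *)
Lemma le_reaches v a b r m s (g : nat -> R) :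
  (forall i, 0 < v i) -> v b <= v a -> (forall c, 0 <= g c) -> (0 < s <= r.+1)%N ->
  \sum_(w in reaches r b s) history_prob v m w * g #|alive w r.+1| <=
  \sum_(w in reaches r a s) history_prob v m w * g #|alive w r.+1|.
Proof.
move=> v0 vab; elim: r m g => [|r IHr] m g g0 /andP[s_gt0].
  by rewrite leq_eqVlt ltnS leqNgt s_gt0 orbF => /eqP->; apply: le_reaches_last.
rewrite leq_eqVlt => /predU1P[->|]; first exact: le_reaches_last.
rewrite ltnS => sr.
have peel c : \sum_(w in reaches r.+1 c s) history_prob v m w * g #|alive w r.+2| =
    \sum_(w in reaches r c s)
      history_prob v (fun t => m (widen_ord (leqnSn r) t)) w *
      ((2 * m ord_max <= #|alive w r.+1|)%N%:R * g (#|alive w r.+1| - m ord_max)%N).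
  rewrite big_mkcond sum_history [RHS]big_mkcond; apply: eq_bigr => w _.
  under eq_bigr do rewrite mem_reaches alive_extend // alive_extend_last.
  rewrite mem_reaches; case: ifP => _; last by rewrite big1.
  rewrite -(expect_card a _ g _ v0) mulr_sumr.
  by apply: eq_bigr => x _; rewrite history_prob_extend mulrA.
rewrite !peel.
apply: (IHr _ (fun c => (2 * m ord_max <= c)%N%:R * g (c - m ord_max)%N)).
  by move=> c; rewrite mulr_ge0 ?ler0n.
by rewrite s_gt0.
Qed.

End Main.

Theorem corollary1 (R : realFieldType) (n : nat) (v : 'I_n -> R)
    (r : nat) (m : 'I_r -> nat) :
  (2 <= n)%N ->
  (forall i : 'I_n, 0 < v i) ->
  (forall i j : 'I_n, (i <= j)%N -> v j <= v i) ->
  is_format n m ->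
  forall s : nat, (1 <= s <= r.+1)%N ->
  forall i j : 'I_n, (i <= j)%N ->
    Pr v m (reaches r i s) >= Pr v m (reaches r j s).
Proof.
move=> _ v0 vle _ s sr i j ij.
have := @le_reaches R n v i j r m s (fun=> 1) v0 (vle _ _ ij) (fun=> ler01) sr.
by under eq_bigr do rewrite mulr1; under [X in _ <= X]eq_bigr do rewrite mulr1.
Qed.
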